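(* Let $C$ be a uniform coloured Petri net, $U$ its unfolding and $S'$ its modified skeleton. Then between the markings of $U$ and $S'$ (i.e. between their reachability graphs, viewed as Kripke structures), a stuttering simulation $\sigma_s$ holds.
   Context: A coloured net $C=[P_C,T_C,F_C,W_C,\chi,\gamma,m_{0C}]$ assigns to each arc a finite set of variables $W_C(x,y)$, to each place a finite colour domain $\chi(p)$, and to each transition a guard $\gamma(t)$ over the arc variables; it is uniform, so each transition consumes/produces $\operatorname{card}(W_C(x,y))$ tokens independently of the firing mode. The unfolding $U$ is the P/T net with places $[p,c]$ ($c\in\chi(p)$), transitions $[t,g]$ for firing modes $g\models\gamma(t)$, arc weights $W_U([p,c],[t,g])=\operatorname{card}\{x\in W_C(p,t)\mid g(x)=c\}$ (analogously for output arcs), and $m_{0U}([p,c])=m_{0C}(p)(c)$. The skeleton $S$ is the P/T net with the same places, transitions and arcs as $C$, weights $W_S(x,y)=\operatorname{card}(W_C(x,y))$ and $m_{0S}(p)=\sum_{c\in\chi(p)}m_{0C}(p)(c)$; markings of $U$ map to markings of $S$ by summing over colours, and this is an abstraction relation (related markings satisfy the same atomic propositions $k_1p_1+\dots+k_np_n\le k$, evaluated on token counts). For $t\in T_C$ let $f(t)=(|W_C(p_1,t)|,\dots,|W_C(p_n,t)|)$; transitions with equal $f$ form classes $[t]$, partially ordered by $f(t)\le f(t')$. A class $[t]$ is full if for every marking $m$ of $C$ with $|m(p_i)|=f_i(t)$ for all $i$, some transition in $[t]$ is enabled in $m$. The modified skeleton $S'$ is obtained from $S$ by adding, for every pre-place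 $p$ of a non-full minimal transition class $[t]$, a complement place $\overline{p}$ and a recipient transition $t_r$ with $\bullet t_r=\{p\}$, $t_r\bullet=\{\overline{p}\}$ and $W(p,t_r)=W(t_r,\overline{p})=1$. A marking $m_S$ of $S$ and a marking $m_{S'}$ of $S'$ are related if $m_S(p)=m_{S'}(p)+m_{S'}(\overline{p})$ for such pre-places $p$ and $m_S(p)=m_{S'}(p)$ otherwise; markings of $U$ and $S'$ are related by composing this with the relation between $U$ and $S$. Reachability graphs are turned into Kripke structures by adding a silent self-loop $(m_d,\tau,m_d)$ at every deadlock marking $m_d$. A mapping $\sigma_s:Q\to\hat Q$ between Kripke structures $K$ and $\hat K$ is a stuttering simulation if $(q_0,\hat q_0)\in\sigma_s$, related states satisfy the same atomic propositions, and for every path $\pi$ of $K$ there is a path $\hat\pi$ of $\hat K$ with partitions $B_0,B_1,\dots$ of $\pi$ and $\hat B_0,\hat B_1,\dots$ of $\hat\pi$ into nonempty finite blocks such that every state of $\hat B_i$ is related by $\sigma_s$ to every state of $B_i$.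
   Formalization: The formal version assumes that a transition class without pre-places is full, i.e. if there are transitions without pre-places, at least one has a firing mode; otherwise a lone source transition with unsatisfiable guard and an output place is a counterexample. *)

(* Defs.v *)
From mathcomp Require Export all_boot all_order all_algebra.
From mathcomp Require Export boolp.

Set Implicit Arguments.
Unset Strict Implicit.
Unset Printing Implicit Defensive.

(* P/T nets.  The arc set F is implicit: (x, y) is an arc iff its weight is
   positive. *)

Record net := Net {
  nplace : finType;
  ntrans : finType;
  pre : nplace -> ntrans -> nat;
  post : ntrans -> nplace -> nat;
  ninit : {ffun nplace -> nat}
}.

Definition marking (N : net) := {ffun nplace N -> nat}.

Definition enabled (N : net) (m : marking N) (t : ntrans N) : bool :=
  [forall p, pre p t <= m p].

Definition fire (N : net) (m : marking N) (t : ntrans N) : marking N :=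
  [ffun p => m p - pre p t + post t p].

Inductive reachable (N : net) : marking N -> Prop :=
| reachable_init : reachable (ninit N)
| reachable_fire (m : marking N) (t : ntrans N) :
    reachable m -> enabled m t -> reachable (fire m t).

Definition deadlock (N : net) (m : marking N) : Prop :=
  forall t : ntrans N, ~~ enabled m t.

Record kripke (AP : Type) := Kripke {
  kstate : Type;
  kact : Type;
  kinit : kstate;
  kstep : kstate -> kact -> kstate -> Prop;
  ksat : kstate -> AP -> Prop
}.

Definition is_path (AP : Type) (K : kripke AP) (pi : nat -> kstate K) : Prop :=
  forall i, exists a, kstep (pi i) a (pi i.+1).

(* The block B_i of the partition with cut points b is
   pi (b i), ..., pi (b i.+1 - 1). *)
Definition block_partition (b : nat -> nat) : Prop :=
  b 0 = 0 /\ forall i, b i < b i.+1.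

(* Paths may start in any state; the clause on initial states makes the
   definition also cover the convention that the paths of a Kripke structure
   are those starting in its initial state. *)
Definition stuttering_simulation (AP : Type) (K K' : kripke AP)
    (sigma : kstate K -> kstate K' -> Prop) : Prop :=
  [/\ sigma (kinit K) (kinit K'),
      forall q q', sigma q q' -> forall a, ksat q a <-> ksat q' a
    & forall pi, is_path pi ->
      exists pi' : nat -> kstate K',
      [/\ is_path pi',
          pi 0 = kinit K -> pi' 0 = kinit K'
        & exists b b' : nat -> nat,
          [/\ block_partition b, block_partition b'
            & forall i j k, b i <= j < b i.+1 -> b' i <= k < b' i.+1 ->
                sigma (pi j) (pi' k)]]].

(* States are the reachable markings; the action None is tau. *)
Definition net_kstep (N : net) (q : {m : marking N | reachable m})
    (a : option (ntrans N)) (q' : {m : marking N | reachable m}) : Prop :=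
  match a with
  | Some t => enabled (sval q) t /\ sval q' = fire (sval q) t
  | None => deadlock (sval q) /\ sval q' = sval q
  end.

Definition net_kripke (N : net) (AP : Type) (sat : marking N -> AP -> Prop) :
    kripke AP :=
  {| kinit := exist (fun m => reachable m) (ninit N) (reachable_init N);
     kstep := @net_kstep N;
     ksat := fun q => sat (sval q) |}.

(* Coloured nets.  [cin p t] and [cout t p] are the variable sets W_C(p,t) and
   W_C(t,p); (x, y) is an arc iff its variable set is nonempty.  [dom p] is
   chi(p).  A marking m assigns m p c tokens of colour c to p; values at
   c \notin dom p are never used.  A guard sees exactly the variables on the
   arcs around its transition. *)

Record coloured_net := ColouredNet {
  place : finType;
  trans : finType;
  var : finType;
  colour : finType;
  cin : place -> trans -> {set var};
  cout : trans -> place -> {set var};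
  dom : place -> {set colour};
  guard : forall t : trans,
    {ffun {x : var | x \in (\bigcup_p cin p t) :|: (\bigcup_p cout t p)}
      -> colour} -> bool;
  cinit : place -> colour -> nat
}.

Definition tvar (C : coloured_net) (t : trans C) : finType :=
  {x : var C | x \in (\bigcup_p cin p t) :|: (\bigcup_p cout t p)}.

Definition assignment (C : coloured_net) (t : trans C) : finType :=
  {ffun tvar t -> colour C}.

(* Variables take values in the colour domains of the places their arcs are
   attached to. *)
Definition firing_mode (C : coloured_net) (t : trans C) (g : assignment t) :
    bool :=
  [&& guard g,
      [forall p, forall x : tvar t, (val x \in cin p t) ==> (g x \in dom p)]
    & [forall p, forall x : tvar t, (val x \in cout t p) ==> (g x \in dom p)]].

Definition win (C : coloured_net) (p : place C) (c : colour C) (t : trans C)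
    (g : assignment t) : nat :=
  #|[set x : tvar t | (val x \in cin p t) && (g x == c)]|.

Definition wout (C : coloured_net) (p : place C) (c : colour C) (t : trans C)
    (g : assignment t) : nat :=
  #|[set x : tvar t | (val x \in cout t p) && (g x == c)]|.

Definition cmarking (C : coloured_net) := place C -> colour C -> nat.

Definition tokens (C : coloured_net) (m : cmarking C) (p : place C) : nat :=
  \sum_(c in dom p) m p c.

Definition cenabled (C : coloured_net) (m : cmarking C) (t : trans C) : Prop :=
  exists2 g : assignment t, firing_mode g &
    forall p c, c \in dom p -> win p c g <= m p c.

(* Uniformity holds by construction: arcs carry sets of variables and firing
   modes respect colour domains. *)

Lemma uniform_in (C : coloured_net) (t : trans C) (g : assignment t) p :
  firing_mode g -> \sum_(c in dom p) win p c g = #|cin p t|.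
Proof.
case/and3P=> _ /forallP/(_ p)/forallP gP _.
have sub x : x \in cin p t ->
    x \in (\bigcup_p cin p t) :|: (\bigcup_p cout t p).
  by move=> xp; rewrite inE; apply/orP; left; apply/bigcupP; exists p.
have -> : cin p t = val @: [set x : tvar t | val x \in cin p t].
  apply/setP=> x; apply/idP/imsetP => [xp|[y]]; last by rewrite inE => ? ->.
  by exists (exist _ x (sub x xp)); rewrite ?inE.
rewrite (card_imset _ val_inj).
rewrite -sum1_card (partition_big g (fun c => c \in dom p)) /=; last first.
  by move=> x; rewrite inE => xp; apply: (implyP (gP x)).
by apply: eq_bigr => c _; rewrite /win -sum1_card; apply: eq_bigl => x; rewrite !inE.
Qed.

Lemma uniform_out (C : coloured_net) (t : trans C) (g : assignment t) p :
  firing_mode g -> \sum_(c in dom p) wout p c g = #|cout t p|.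
Proof.
case/and3P=> _ _ /forallP/(_ p)/forallP gP.
have sub x : x \in cout t p ->
    x \in (\bigcup_p cin p t) :|: (\bigcup_p cout t p).
  by move=> xp; rewrite inE; apply/orP; right; apply/bigcupP; exists p.
have -> : cout t p = val @: [set x : tvar t | val x \in cout t p].
  apply/setP=> x; apply/idP/imsetP => [xp|[y]]; last by rewrite inE => ? ->.
  by exists (exist _ x (sub x xp)); rewrite ?inE.
rewrite (card_imset _ val_inj).
rewrite -sum1_card (partition_big g (fun c => c \in dom p)) /=; last first.
  by move=> x; rewrite inE => xp; apply: (implyP (gP x)).
by apply: eq_bigr => c _; rewrite /wout -sum1_card; apply: eq_bigl => x; rewrite !inE.
Qed.

Definition uplace (C : coloured_net) : finType :=
  {pc : place C * colour C | pc.2 \in dom pc.1}.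

Definition utrans (C : coloured_net) : finType :=
  {t : trans C & {g : assignment t | firing_mode g}}.

Definition unfolding (C : coloured_net) : net :=
  {| nplace := uplace C;
     ntrans := utrans C;
     pre := fun s u => win (val s).1 (val s).2 (val (tagged u));
     post := fun u s => wout (val s).1 (val s).2 (val (tagged u));
     ninit := [ffun s => cinit (val s).1 (val s).2] |}.

Definition skeleton (C : coloured_net) : net :=
  {| nplace := place C;
     ntrans := trans C;
     pre := fun p t => #|cin p t|;
     post := fun t p => #|cout t p|;
     ninit := [ffun p => tokens (@cinit C) p] |}.

(* The class [t] is represented by any of its members: t' is in [t] iff
   fvec t' = fvec t. *)

Definition fvec (C : coloured_net) (t : trans C) : {ffun place C -> nat} :=
  [ffun p => #|cin p t|].

Definition class_le (C : coloured_net) (t t' : trans C) : Prop :=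
  forall p, fvec t p <= fvec t' p.

Definition minimal_class (C : coloured_net) (t : trans C) : Prop :=
  forall t', class_le t' t -> fvec t' = fvec t.

Definition full_class (C : coloured_net) (t : trans C) : Prop :=
  forall m : cmarking C, (forall p, tokens m p = fvec t p) ->
    exists2 t', fvec t' = fvec t & cenabled m t'.

Definition complemented (C : coloured_net) (p : place C) : Prop :=
  exists t : trans C, [/\ minimal_class t, ~ full_class t & cin p t != set0].

(* An index p : compl C stands both for the complement place of p and for its
   recipient transition. *)
Definition compl (C : coloured_net) : finType :=
  {p : place C | `[< complemented p >]}.

Definition modified_skeleton (C : coloured_net) : net :=
  {| nplace := (place C + compl C)%type;
     ntrans := (trans C + compl C)%type;
     pre := fun s u =>
       match s, u with
       | inl p, inl t => @pre (skeleton C) p t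
       | inl p, inr r => p == val r
       | inr _, _ => 0
       end;
     post := fun u s =>
       match u, s with
       | inl t, inl p => @post (skeleton C) t p
       | inr r, inr d => r == d
       | _, _ => 0
       end;
     ninit := [ffun s => if s is inl p then ninit (skeleton C) p else 0] |}.

Definition rel_US (C : coloured_net) (mU : marking (unfolding C))
    (mS : marking (skeleton C)) : Prop :=
  forall p : place C, mS p = \sum_(s : uplace C | (val s).1 == p) mU s.

Definition rel_SS' (C : coloured_net) (mS : marking (skeleton C))
    (mS' : marking (modified_skeleton C)) : Prop :=
  (forall d : compl C, mS (val d) = mS' (inl (val d)) + mS' (inr d)) /\
  (forall p : place C, ~ complemented p -> mS p = mS' (inl p)).

Definition rel_US' (C : coloured_net) (mU : marking (unfolding C))
    (mS' : marking (modified_skeleton C)) : Prop :=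
  exists2 mS : marking (skeleton C), rel_US mU mS & rel_SS' mS mS'.

(* (k, b) is the proposition k_1 p_1 + ... + k_n p_n <= b over the places of
   the coloured net. *)
Definition atom (C : coloured_net) : Type := ({ffun place C -> int} * int)%type.

Definition atom_holds (C : coloured_net) (count : place C -> nat)
    (a : atom C) : Prop :=
  (\sum_(p : place C) a.1 p * (count p)%:Z <= a.2)%R.

Definition sat_U (C : coloured_net) (m : marking (unfolding C)) : atom C -> Prop :=
  atom_holds (fun p => \sum_(s : uplace C | (val s).1 == p) m s).

(* Tokens moved to a complement place still count for the original place. *)
Definition sat_S' (C : coloured_net) (m : marking (modified_skeleton C)) :
    atom C -> Prop :=
  atom_holds (fun p => m (inl p) + \sum_(d : compl C | val d == p) m (inr d)).

Definition kripke_U (C : coloured_net) : kripke (atom C) :=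
  net_kripke (@sat_U C).

Definition kripke_S' (C : coloured_net) : kripke (atom C) :=
  net_kripke (@sat_S' C).

Definition sigma_s (C : coloured_net) (q : kstate (kripke_U C))
    (q' : kstate (kripke_S' C)) : Prop :=
  rel_US' (sval q) (sval q').

(* Main.v *)
Require Import Defs.

(** Summing over colours and leaving every complement place empty maps firing
    sequences of the unfolding to firing sequences of the modified skeleton, so
    only deadlocks of the unfolding matter.  From the image of a deadlock, fire
    recipient transitions, which preserve the relation, until the complemented
    places are empty.  The result is a deadlock, where tau can be repeated: an
    enabled transition would yield an enabled minimal one; if its class is full,
    choosing tokens of the deadlocked marking enables some mode of the class in
    the unfolding, and otherwise one of its pre-places is complemented, hence
    empty.  Since a recipient step or tau answers each tau, blocks of length one
    are enough. *)

Set Implicit Arguments.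
Unset Strict Implicit.
Unset Printing Implicit Defensive.

(** Fullness of a class concerns exact token counts only; this selects that many tokens from a
    larger marking. *)
Lemma exists_subsum (T : finType) (A : {set T}) (F : T -> nat) (k : nat) :
  k <= \sum_(c in A) F c ->
  exists2 G : T -> nat, \sum_(c in A) G c = k & forall c, G c <= F c.
Proof.
elim: k => [|k IHk] kF; first by exists (fun=> 0) => //; rewrite big1.
have [G sumG leGF] := IHk (ltnW kF).
have [c cA ltGF] : exists2 c, c \in A & G c < F c.
  apply: contrapT => noc; move: kF; rewrite -sumG ltnNge => /negP; apply.
  apply: leq_sum => c cA; rewrite leqNgt; apply/negP => ltGF.
  by apply: noc; exists c.
exists (fun x => G x + (x == c)); last first.
  by move=> x; case: eqP => [->|_]; rewrite ?addn1 ?addn0.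
rewrite big_split /= sumG (bigD1 c) //= eqxx big1 ?addn0 ?addn1 // => x.
by case/andP=> _ /negbTE ->.
Qed.

Section Simulation.

Variable C : coloured_net.

Implicit Types (mU : marking (unfolding C)) (m : marking (modified_skeleton C)).
Implicit Types (p : place C) (t : trans C).

(** * Summing over colours: from the unfolding to the skeleton *)

Lemma sum_uplace (F : place C -> colour C -> nat) p :
  \sum_(s : uplace C | (val s).1 == p) F (val s).1 (val s).2 =
  \sum_(c in dom p) F p c.
Proof.
pose i c : option (uplace C) := insub (p, c).
rewrite [RHS](reindex_omap (fun s : uplace C => (val s).2) i) /=; last first.
  by move=> c cp; rewrite /i insubT.
rewrite big_mkcond [RHS]big_mkcond /=; apply: eq_bigr => -[[q c] /= qc] _.
rewrite /i; case: (eqVneq q p) => [qp|qp].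
  by subst q; rewrite qc insubT /= eqE /= eqxx.
case: insubP => [u _ /= uE|]; last by rewrite andbF.
rewrite ifF //; apply/negbTE/negP => /andP[_ /eqP[E]].
by move: uE; rewrite E => -[/eqP]; rewrite (negbTE qp).
Qed.

Definition cmarking_of mU : cmarking C := fun p c =>
  if insub (p, c) is Some s then mU s else 0.

Lemma cmarking_ofE mU (s : uplace C) :
  cmarking_of mU (val s).1 (val s).2 = mU s.
Proof. by rewrite /cmarking_of -surjective_pairing valK. Qed.

Definition project mU : marking (skeleton C) :=
  [ffun p => \sum_(s : uplace C | (val s).1 == p) mU s].

Lemma project_tokens mU p : project mU p = tokens (cmarking_of mU) p.
Proof.
rewrite ffunE /tokens -sum_uplace.
by apply: eq_bigr => s _; rewrite cmarking_ofE.
Qed.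

Lemma rel_USE mU mS : rel_US mU mS <-> mS = project mU.
Proof.
split=> [rel|-> p]; last by rewrite ffunE.
by apply/ffunP => p; rewrite ffunE.
Qed.

Lemma project_init : project (ninit (unfolding C)) = ninit (skeleton C).
Proof.
apply/ffunP => p; rewrite !ffunE /tokens -sum_uplace.
by apply: eq_bigr => s _; rewrite ffunE.
Qed.

Lemma sum_pre (u : utrans C) p :
  \sum_(s : uplace C | (val s).1 == p) @pre (unfolding C) s u =
  #|cin p (tag u)|.
Proof.
rewrite (sum_uplace (fun p c => win p c (val (tagged u)))).
exact: uniform_in (valP (tagged u)).
Qed.

Lemma sum_post (u : utrans C) p :
  \sum_(s : uplace C | (val s).1 == p) @post (unfolding C) u s =
  #|cout (tag u) p|.
Proof.
rewrite (sum_uplace (fun p c => wout p c (val (tagged u)))).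
exact: uniform_out (valP (tagged u)).
Qed.

Lemma project_enabled mU (u : utrans C) :
  enabled mU (u : ntrans (unfolding C)) ->
  enabled (project mU) (tag u : ntrans (skeleton C)).
Proof.
move=> /forallP en; apply/forallP => p /=.
by rewrite ffunE -sum_pre; apply: leq_sum.
Qed.

Lemma project_fire mU (u : utrans C) :
  enabled mU (u : ntrans (unfolding C)) ->
  project (fire mU (u : ntrans (unfolding C))) =
  fire (project mU) (tag u : ntrans (skeleton C)).
Proof.
move=> /forallP en; apply/ffunP => p; rewrite !ffunE /= -sum_pre -sum_post.
(* Truncated subtraction commutes with the sum because [en] bounds it termwise. *)
rewrite -sumnB // -big_split /=; apply: eq_bigr => s _.
by rewrite ffunE.
Qed.

(** * Empty complement places: from the skeleton to the modified skeleton *)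

Definition extend (mS : marking (skeleton C)) : marking (modified_skeleton C) :=
  [ffun s => if s is inl p then mS p else 0].

Lemma extend_enabled (mS : marking (skeleton C)) t :
  enabled mS (t : ntrans (skeleton C)) ->
  enabled (extend mS) (inl t : ntrans (modified_skeleton C)).
Proof.
move=> /forallP en; apply/forallP => -[p|d] //=; rewrite ffunE; exact: en.
Qed.

Lemma extend_fire (mS : marking (skeleton C)) t :
  extend (fire mS (t : ntrans (skeleton C))) =
  fire (extend mS) (inl t : ntrans (modified_skeleton C)).
Proof. by apply/ffunP => -[p|d]; rewrite !ffunE. Qed.

Lemma extend_init :
  extend (ninit (skeleton C)) = ninit (modified_skeleton C).
Proof. by []. Qed.

Lemma rel_SS'_extend (mS : marking (skeleton C)) : rel_SS' mS (extend mS).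
Proof. by split=> [d|p _]; rewrite !ffunE ?addn0. Qed.

Lemma reachable_extend_project mU :
  reachable mU -> reachable (extend (project mU)).
Proof.
elim=> [|{}mU u _ IH en].
  by rewrite project_init extend_init; apply: reachable_init.
rewrite project_fire // extend_fire; apply: reachable_fire => //.
exact/extend_enabled/project_enabled.
Qed.

(** * Invariants of the composed relation *)

Lemma rel_US'_sat mU m : rel_US' mU m ->
  forall a : atom C, sat_U mU a <-> sat_S' m a.
Proof.
move=> [mS relU [relc reln]] a; rewrite /sat_U /sat_S' /atom_holds.
suff E p : \sum_(s : uplace C | (val s).1 == p) mU s =
    m (inl p) + \sum_(d : compl C | val d == p) m (inr d).
  by under eq_bigr do rewrite E.
(* The sum over [d] has one term if [p] is complemented and none otherwise. *)
rewrite -relU; have [cp|ncp] := pselect (complemented p); last first.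
  rewrite reln // big_pred0 ?addn0 // => d; apply/negP => /eqP dp.
  by apply: ncp; rewrite -dp; apply/asboolP/(valP d).
have cpb : `[< complemented p >] by apply/asboolP.
have := relc (exist _ p cpb) => /= ->; congr (_ + _).
by rewrite (big_pred1 (exist _ p cpb)).
Qed.

Lemma rel_US'_recipient mU m (r : compl C) :
  enabled m (inr r : ntrans (modified_skeleton C)) -> rel_US' mU m ->
  rel_US' mU (fire m (inr r : ntrans (modified_skeleton C))).
Proof.
move=> /forallP/(_ (inl (val r))) /= en [mS relU [relc reln]].
exists mS => //; split=> [d|p ncp]; rewrite !ffunE /=; last first.
  rewrite reln //; suff /negbTE -> : p != val r by rewrite subn0 addn0.
  by apply/eqP => pr; apply: ncp; rewrite pr; apply/asboolP/(valP r).
rewrite relc subn0 addn0 [r == d]eq_sym (inj_eq val_inj).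
case: (eqVneq d r) => [->|_]; last by rewrite subn0 addn0.
by rewrite addn1 addnS -addSn subn1 prednK //; move: en; rewrite eqxx.
Qed.

(** * Deadlocks after draining *)

Lemma minimal_class_below t : exists2 t0, minimal_class t0 & class_le t0 t.
Proof.
pose le t1 := [forall p, fvec t1 p <= fvec t p].
have le_t : le t by apply/forallP.
(* Take the least total weight below [t]: anything below [t0] then has the same total, and termwise
   inequality with equal sums is equality. *)
case: (arg_minnP (fun t1 => \sum_p fvec t1 p) le_t) => t0 /forallP le0 min0.
exists t0 => // t1 le10; apply/ffunP => p; apply/eqP.
have le1 : le t1 by apply/forallP => q; apply: leq_trans (le10 q) (le0 q).
have sums : \sum_p fvec t1 p == \sum_p fvec t0 p.
  by rewrite eqn_leq min0 // andbT; apply: leq_sum => q _; apply: le10.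
have := leqif_sum (fun q (_ : true) => leqif_eq (le10 q)).
by case=> _; rewrite sums => /esym/forallP/(_ p).
Qed.

(** Fullness enables a mode in a submarking [G] with exactly [fvec t] tokens, and enabledness is
    monotone in the marking. *)
Lemma full_class_not_deadlock mU t : full_class t ->
  (forall p, fvec t p <= project mU p) -> ~ deadlock mU.
Proof.
move=> full le_m dead.
have sub p : exists G : colour C -> nat,
    \sum_(c in dom p) G c = fvec t p /\ forall c, G c <= cmarking_of mU p c.
  have := le_m p; rewrite project_tokens => /exists_subsum[G sumG leG].
  by exists G.
have [G GP] := choice sub.
have [t' _ [g mode_g en_g]] := full G (fun p => (GP p).1).
have /negP := dead (Tagged (fun t => {g : assignment t | firing_mode g})
                      (exist (fun g : assignment t' => firing_mode g) g mode_g)).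
apply; apply/forallP => s /=; rewrite -cmarking_ofE.
exact: leq_trans (en_g _ _ (valP s)) ((GP _).2 _).
Qed.

(** A non-full class without pre-places would get no complement place: it would stay enabled in the
    modified skeleton even where the unfolding is deadlocked. *)
Hypothesis source_full : forall t : trans C,
  (forall p : place C, cin p t = set0) -> full_class t.

Lemma drained_deadlock mU m : deadlock mU -> rel_US' mU m ->
  (forall r : compl C, ~~ enabled m (inr r : ntrans (modified_skeleton C))) ->
  deadlock m.
Proof.
move=> dead [mS /rel_USE -> [relc reln]] drained [t|r] //; apply/negP => en.
have empty p : complemented p -> m (inl p) = 0.
  move=> /asboolP cp; have := drained (exist _ p cp).
  apply: contraNeq; rewrite -lt0n => mp; apply/forallP => -[q|d] //=.
  by case: eqP => // ->.
have le_m p : m (inl p) <= project mU p.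
  have [/asboolP cp|ncp] := pselect (complemented p); last by rewrite reln.
  by have := relc (exist _ p cp) => /= ->; apply: leq_addr.
have [t0 min0 le0] := minimal_class_below t.
have en0 p : fvec t0 p <= m (inl p).
  by apply: leq_trans (le0 p) _; rewrite ffunE; apply: (forallP en (inl p)).
have [full0|nfull0] := pselect (full_class t0).
  by apply: (full_class_not_deadlock full0 _ dead) => p; apply: leq_trans (le_m p).
(* A pre-place of [t0] would be complemented, hence empty, against [en0]; so [t0] has none and
   [source_full] applies. *)
case: (nfull0); apply: source_full => p; apply: contrapT => /eqP cin_p.
have := en0 p; rewrite empty; last by exists t0.
by rewrite ffunE leqNgt card_gt0 cin_p.
Qed.

(** * Answering a path of the unfolding *)

Notation stateU := (kstate (kripke_U C)).
Notation stateS := (kstate (kripke_S' C)).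

Definition image (q : stateU) : stateS :=
  exist _ (extend (project (sval q))) (reachable_extend_project (svalP q)).

Lemma sigma_image q : sigma_s q (image q).
Proof. by exists (project (sval q)); [apply/rel_USE|apply: rel_SS'_extend]. Qed.

Lemma image_init : image (kinit (kripke_U C)) = kinit (kripke_S' C).
Proof. by apply: eq_exist; rewrite /= project_init extend_init. Qed.

Lemma image_step (q q' : stateU) (u : utrans C) :
  kstep q (Some u) q' -> kstep (image q) (Some (inl (tag u))) (image q').
Proof.
case=> en fireE; split; first exact/extend_enabled/project_enabled.
by rewrite /= fireE project_fire // extend_fire.
Qed.

(** The hypotheses stand under the existential so that [choice] yields a total function of [q] and
    [s]. *)
Lemma deadlock_step (q : stateU) (s : stateS) : exists s' : stateS,
  deadlock (sval q) -> sigma_s q s ->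
  (exists a, kstep s a s') /\ sigma_s q s'.
Proof.
have [[r en]|nor] := pselect
    (exists r : compl C, enabled (sval s) (inr r : ntrans (modified_skeleton C))).
  exists (exist _ _ (reachable_fire (svalP s) en)) => dead rel.
  by split; [exists (Some (inr r))|apply: rel_US'_recipient].
exists s => dead rel; split=> //; exists None; split=> //.
apply: drained_deadlock dead rel _ => r; apply/negP => en.
by apply: nor; exists r.
Qed.

End Simulation.

Theorem theorem3 (C : coloured_net)
    (source_full : forall t : trans C,
       (forall p : place C, cin p t = set0) -> full_class t) :
  stuttering_simulation (@sigma_s C).
Proof.
split=> [|q q' /rel_US'_sat //|pi path_pi].
  by rewrite -image_init; apply: sigma_image.
have [drain drainP] :=
  choice (fun qs : _ * _ => deadlock_step source_full qs.1 qs.2).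
pose pi' := fix pi' i := if i is i'.+1 then
    if `[< deadlock (sval (pi i')) >] then drain (pi i', pi' i')
    else image (pi i)
  else image (pi 0).
have tau_pi i : deadlock (sval (pi i)) -> pi i.+1 = pi i.
  move=> dead; have [[u|] [/= en E]] := path_pi i.
    by have := dead u; rewrite en.
  by case: (pi i.+1) (pi i) E => [m1 h1] [m2 h2] /= E; apply: eq_exist.
(* The second half lets [image_step] apply before a deadlock; it survives draining because [tau_pi]
   keeps [pi] in its deadlock. *)
have inv i : sigma_s (pi i) (pi' i) /\
    (~ deadlock (sval (pi i)) -> pi' i = image (pi i)).
  elim: i => [|i [rel _]] /=; first by split=> //; apply: sigma_image.
  case: asboolP => [dead|_]; last by split=> //; apply: sigma_image.
  rewrite tau_pi //; split=> //.
  exact: (drainP (pi i, pi' i) dead rel).2.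
exists pi'; split=> [i|pi0|].
- have [rel imE] := inv i; rewrite /=; case: asboolP => [dead|ndead].
    exact: (drainP (pi i, pi' i) dead rel).1.
  have [[u|] step] := path_pi i; last by case: step.
  by rewrite imE //; exists (Some (inl (tag u))); apply: image_step.
- by rewrite /= pi0 image_init.
- exists id, id; split=> // i j k; rewrite !ltnS -!eqn_leq.
  by move=> /eqP <- /eqP <-; exact: (inv i).1.
Qed.
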